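(* Let $\bar{\mathcal G}$ be a (time-invariant) digraph on the node set $\{0,1,\dots,N\}$ with weighted adjacency matrix $[a_{ij}]_{i,j=0}^N$, such that every node $i=1,\dots,N$ is reachable from node $0$, and let $H\in\mathbb R^{N\times N}$ be the associated matrix defined in the context. Let $S_0\in\mathbb R^{q\times q}$ have eigenvalues $\lambda_1,\dots,\lambda_q$ with $0\le|\lambda_1|\le\cdots\le|\lambda_q|$ and $\lambda_q\ne 0$. Denote the eigenvalues of $H$ (with multiplicity) by $a_l\pm \mathrm{j}\,b_l$, $l=1,\dots,N_2$, where $\mathrm j=\sqrt{-1}$, $a_l,b_l\in\mathbb R$, $b_l=0$ for $1\le l\le N_1$ (each such $l$ contributing the single real eigenvalue $a_l$), $b_l\neq 0$ for $N_1+1\le l\le N_2$ (each such $l$ contributing a complex conjugate pair), $0\le N_1\le N$ and $N_1+2(N_2-N_1)=N$. Put $\Delta_l=\frac{a_l^2+b_l^2}{|\lambda_q|^2}-b_l^2$. Case (i): Suppose in addition that $\bar{\mathcal G}$ is undirected (so that $b_l=0$ for all $l$ and $N_2=N$). Then there exists a real number $\mu$ such that $(I_N\otimes S_0)-\mu(H\otimes S_0)$ is Schur if and only if $$\max_{l=1,\dots,N}\left\{\frac{|\lambda_q|-1}{a_l|\lambda_q|}\right\}<\min_{l=1,\dots,N}\left\{\frac{|\lambda_q|+1}{a_l|\lambda_q|}\right\}.$$ And, if this condition is satisfied, $(I_N\otimes S_0)-\mu(H\otimes S_0)$ is Schur for all $\mu$ satisfying $$\max_{l=1,\dots,N}\left\{\frac{|\lambda_q|-1}{a_l|\lambda_q|}\right\}<\mu<\min_{l=1,\dots,N}\left\{\frac{|\lambda_q|+1}{a_l|\lambda_q|}\right\}.$$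 Case (ii): Suppose in addition (to the reachability assumption, and without assuming $\bar{\mathcal G}$ undirected) that all eigenvalues of $S_0$ have modulus equal to or smaller than $1$. Then $(I_N\otimes S_0)-\mu(H\otimes S_0)$ is Schur for all $\mu$ satisfying $$\max_{l=1,\dots,N_2}\left\{\frac{a_l-\sqrt{\Delta_l}}{a_l^2+b_l^2}\right\}<\mu<\min_{l=1,\dots,N_2}\left\{\frac{a_l+\sqrt{\Delta_l}}{a_l^2+b_l^2}\right\}.$$
   Context: A digraph $\bar{\mathcal G}=(\bar{\mathcal V},\bar{\mathcal E})$ has node set $\bar{\mathcal V}=\{0,1,\dots,N\}$ and edge set $\bar{\mathcal E}\subseteq\bar{\mathcal V}\times\bar{\mathcal V}$; $(i,j)\in\bar{\mathcal E}$ denotes an edge from $i$ to $j$. Node $i_{k+1}$ is reachable from node $i_1$ if there are edges $(i_1,i_2),(i_2,i_3),\dots,(i_k,i_{k+1})$ in $\bar{\mathcal E}$. A weighted adjacency matrix is $[a_{ij}]\in\mathbb R^{(N+1)\times(N+1)}$, $i,j=0,\dots,N$, with $a_{ii}=0$, and, for $i\ne j$, $a_{ij}>0$ if $(j,i)\in\bar{\mathcal E}$ and $a_{ij}=0$ otherwise. An edge $(i,j)\in\bar{\mathcal E}$ is undirected if also $(j,i)\in\bar{\mathcal E}$, in which case $a_{ij}=a_{ji}$; the digraph is undirected if all its edges are undirected. The matrix $H=[h_{ij}]\in\mathbb R^{N\times N}$, $i,j=1,\dots,N$, is defined by $h_{ii}=\sum_{j=0}^N a_{ij}$ and $h_{ij}=-a_{ij}$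 for $i\ne j$. (If the graph is undirected and every node is reachable from node $0$, $H$ is symmetric and positive definite.) The entries $a_{ij}$ with two indices are adjacency weights; $a_l$ with one index is the real part of an eigenvalue of $H$. A square matrix is Schur if all its eigenvalues have modulus smaller than $1$. $\otimes$ is the Kronecker product. *)

(* Defs.v *)
From mathcomp Require Import all_boot all_order all_algebra reals.
From mathcomp Require Import complex mxtens.

Set Implicit Arguments.
Unset Strict Implicit.
Unset Printing Implicit Defensive.

Import Order.TTheory GRing.Theory Num.Theory.
Import Normc.

Local Open Scope ring_scope.
Local Open Scope complex_scope.

(* The digraph has nodes 'I_N.+1, and E i j means that there is an edge from i
   to j.  The weight A i j is carried by the edge from j to i. *)
Definition weighted_adjacency (R : realType) (N : nat)
    (E : rel 'I_N.+1) (A : 'M[R]_N.+1) : Prop :=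
  (forall i, A i i = 0) /\
  (forall i j, i != j -> E j i -> 0 < A i j) /\
  (forall i j, i != j -> ~~ E j i -> A i j = 0).

Definition undirected (R : realType) (N : nat)
    (E : rel 'I_N.+1) (A : 'M[R]_N.+1) : Prop :=
  forall i j, E i j -> E j i /\ A i j = A j i.

(* The index i : 'I_N of a row of H stands for the node lift ord0 i = i.+1; the
   diagonal sum includes the weight of the edge coming from node 0. *)
Definition Hmatrix (R : realType) (N : nat) (A : 'M[R]_N.+1) : 'M[R]_N :=
  \matrix_(i < N, j < N)
    if i == j then \sum_(k < N.+1) A (lift ord0 i) k
    else - A (lift ord0 i) (lift ord0 j).

Definition cplx_mx (R : realType) (m n : nat) (M : 'M[R]_(m, n)) :
    'M[R[i]]_(m, n) := map_mx (real_complex R) M.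

Definition is_Schur (R : realType) (n : nat) (M : 'M[R]_n) : Prop :=
  forall z : R[i], eigenvalue (cplx_mx M) z -> normc z < 1.

(* Equality of the characteristic polynomial with the product of linear factors
   expresses "eigenvalues listed with multiplicity". *)
Definition eigenvalues_of (R : realType) (n : nat) (M : 'M[R]_n)
    (lam : 'I_n -> R[i]) : Prop :=
  char_poly (cplx_mx M) = \prod_(k < n) ('X - (lam k)%:P).

(* Indices start at 0: those l < N1 give the real eigenvalue a l, those with
   N1 <= l < N2 give the conjugate pair a l +i* b l, a l -i* b l. *)
Definition paired_eigenvalues_of (R : realType) (N : nat) (M : 'M[R]_N)
    (N1 N2 : nat) (a b : nat -> R) : Prop :=
  [/\ (N1 <= N)%N, (N1 <= N2)%N & (N1 + 2 * (N2 - N1))%N = N] /\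
  [/\ forall l, (l < N1)%N -> b l = 0,
      forall l, (N1 <= l < N2)%N -> b l != 0 &
      char_poly (cplx_mx M) =
        (\prod_(0 <= l < N1) ('X - ((a l)%:C)%:P)) *
        (\prod_(N1 <= l < N2)
           (('X - (a l +i* b l)%:P) * ('X - (a l -i* b l)%:P)))].

(* Maximum and minimum of f 0, ..., f n.-1, for n > 0. *)
Definition max_below (R : realType) (n : nat) (f : nat -> R) : R :=
  \big[Num.max/f 0%N]_(0 <= l < n) f l.

Definition min_below (R : realType) (n : nat) (f : nat -> R) : R :=
  \big[Num.min/f 0%N]_(0 <= l < n) f l.

Definition Delta (R : realType) (r a b : R) : R :=
  (a ^+ 2 + b ^+ 2) / r ^+ 2 - b ^+ 2.

Definition closed_loop (R : realType) (N q : nat) (S0 : 'M[R]_q)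
    (H : 'M[R]_N) (mu : R) : 'M[R]_(N * q) :=
  (1%:M *t S0) - mu *: (H *t S0).

(* Main.v *)
(* The closed-loop matrix is [(I - mu H) ⊗ S0].  Each of its eigenspaces is
   stable under the commuting matrices [H ⊗ I] and [I ⊗ S0], hence contains a
   common eigenvector of them; so its eigenvalues are the products
   [(1 - mu h) s] of eigenvalues [h] of [H] and [s] of [S0], and it is Schur iff
   [|1 - mu h| |lam_q| < 1] for all [h].  With [h = a + j b] and
   [c = a^2 + b^2] one has [c |1 - mu h|^2 = (mu c - a)^2 + b^2], which turns
   this into the interval condition on [mu].  On an undirected graph, a left
   eigenvector [v] of [H] for [z], extended by 0 to node 0, satisfies
   [2 z |v|^2 = sum_(i,j) a_ij |v_i - v_j|^2], so that [z] is real and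
   nonnegative; reachability from node 0 excludes [z = 0]. *)
Require Import Defs.
From mathcomp Require Import all_boot all_order all_algebra reals.
From mathcomp Require Import complex mxtens.
From mathcomp Require Import ring lra.

Set Implicit Arguments.
Unset Strict Implicit.
Unset Printing Implicit Defensive.

Import Order.TTheory GRing.Theory Num.Theory.
Import Normc.

Local Open Scope ring_scope.

(** * Algebra of the Kronecker product *)

Lemma tensmxDl (R : pzRingType) m n p q (A B : 'M[R]_(m, n)) (C : 'M[R]_(p, q)) :
  (A + B) *t C = A *t C + B *t C.
Proof.
by apply/matrixP => i j; rewrite !mxE mulrDl.
Qed.

Lemma tensmxDr (R : pzRingType) m n p q (A : 'M[R]_(m, n)) (B C : 'M[R]_(p, q)) :
  A *t (B + C) = A *t B + A *t C.
Proof.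
by apply/matrixP => i j; rewrite !mxE mulrDr.
Qed.

Lemma tensmxZl (R : pzRingType) m n p q c (A : 'M[R]_(m, n)) (B : 'M[R]_(p, q)) :
  (c *: A) *t B = c *: (A *t B).
Proof.
by apply/matrixP => i j; rewrite !mxE mulrA.
Qed.

Lemma tensmxZr (R : comPzRingType) m n p q c (A : 'M[R]_(m, n)) (B : 'M[R]_(p, q)) :
  A *t (c *: B) = c *: (A *t B).
Proof.
by apply/matrixP => i j; rewrite !mxE mulrCA.
Qed.

Lemma tensmx11 (R : pzRingType) m n : 1%:M *t 1%:M = 1%:M :> 'M[R]_(m * n).
Proof.
apply/matrixP => i j; case: (mxtens_indexP i) => a b.
case: (mxtens_indexP j) => c d; rewrite !(mxE, tensmxE).
rewrite (inj_eq (can_inj (@mxtens_indexK m n))) xpair_eqE.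
by case: (a == c); case: (b == d); rewrite ?(mulr0, mul0r, mulr1).
Qed.

Lemma tensmx_scalar1 (R : comPzRingType) m n (c : R) :
  c%:M *t 1%:M = c%:M :> 'M[R]_(m * n).
Proof. by rewrite -[in LHS](scalemx1 m c) tensmxZl tensmx11 scalemx1. Qed.

Lemma tensmx_1scalar (R : comPzRingType) m n (c : R) :
  1%:M *t c%:M = c%:M :> 'M[R]_(m * n).
Proof. by rewrite -[in LHS](scalemx1 n c) tensmxZr tensmx11 scalemx1. Qed.

Lemma tensmx_neq0 (F : fieldType) m n (u : 'rV[F]_m) (v : 'rV[F]_n) :
  u != 0 -> v != 0 -> u *t v != 0.
Proof.
move=> /rV0Pn[i ui] /rV0Pn[j vj]; apply/eqP => /matrixP.
move=> /(_ (mxtens_index (0, 0)) (mxtens_index (i, j))).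
by rewrite tensmxE mxE => /eqP; rewrite mulf_eq0 (negPf ui) (negPf vj).
Qed.

(** * Common eigenvectors and the spectrum of the closed loop *)

Section StableEigenvectors.
Variable F : fieldType.

(** Induction on [s]: either the first factor [B - c%:M] kills [V], which then lies in an
    eigenspace, or the image of [V] is a nonzero stable subspace of [V] annihilated by the product
    of the remaining factors. *)
Lemma stable_eigenvector n (V B : 'M[F]_n) (s : seq F) :
  \prod_(c <- s) (B - c%:M) = 0 -> V != 0 -> stablemx V B ->
  exists2 c, c \in s & (V :&: eigenspace B c)%MS != 0.
Proof.
move=> prod0 V0 VB.
have {prod0} : V *m \prod_(c <- s) (B - c%:M) = 0 by rewrite prod0 mulmx0.
elim: s V V0 VB => [|c s IHs] V V0 VB.
  by rewrite big_nil mulmx1 => V00; rewrite V00 eqxx in V0.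
rewrite big_cons mulmxA => Vprod.
have [Vc0|Vc0] := eqVneq (V *m (B - c%:M)) 0.
  exists c; first by rewrite mem_head.
  have/capmx_idPl/eqmx_eq0 -> // : (V <= eigenspace B c)%MS by apply/sub_kermxP.
have VcV : (V *m (B - c%:M) <= V)%MS.
  by rewrite mulmxBr addmx_sub // -?mulNmx mul_mx_scalar -?scaleN1r ?scalemx_sub.
have VcB : stablemx (V *m (B - c%:M)) B.
  rewrite -mulmxA mulmxBl mul_scalar_mx -mul_mx_scalar -mulmxBr.
  by rewrite mulmxA submxMr.
have [d ds Vd] := IHs _ Vc0 VcB Vprod.
exists d; first by rewrite inE ds orbT.
by apply: contraNneq Vd => Vd0; rewrite -submx0 -Vd0 capmxS.
Qed.

Lemma char_poly_prod0 n (B : 'M[F]_n) (s : seq F) :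
  char_poly B = \prod_(c <- s) ('X - c%:P) -> \prod_(c <- s) (B - c%:M) = 0.
Proof.
case: n B => [|n] B Bs; first by rewrite [LHS]flatmx0 [RHS]flatmx0.
rewrite -(Cayley_Hamilton B) Bs rmorph_prod /=.
by apply: eq_bigr => c _; rewrite rmorphB /= horner_mx_X horner_mx_C.
Qed.

(** Tensoring with the identity is a ring morphism preserving scalar matrices, so an annihilating
    product for [M] lifts to [M *t 1%:M]; the next lemma treats the other factor. *)
Lemma tensmx1_prod m n (M : 'M[F]_m) (s : seq F) :
  \prod_(c <- s) (M *t 1%:M - c%:M) = (\prod_(c <- s) (M - c%:M)) *t 1%:M
  :> 'M_(m * n).
Proof.
elim: s => [|c s IHs]; first by rewrite !big_nil tensmx11.
rewrite !big_cons IHs -[X in _ - X](tensmx_scalar1 m n).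
rewrite -[in LHS]scaleN1r -tensmxZl -tensmxDl scaleN1r.
by rewrite -[LHS]/(_ *m _) tensmx_mul mulmx1.
Qed.

Lemma tens1mx_prod m n (M : 'M[F]_n) (s : seq F) :
  \prod_(c <- s) (1%:M *t M - c%:M) = 1%:M *t (\prod_(c <- s) (M - c%:M))
  :> 'M_(m * n).
Proof.
elim: s => [|c s IHs]; first by rewrite !big_nil tensmx11.
rewrite !big_cons IHs -[X in _ - X](tensmx_1scalar m n).
rewrite -[in LHS]scaleN1r -tensmxZr -tensmxDr scaleN1r.
by rewrite -[LHS]/(_ *m _) tensmx_mul mulmx1.
Qed.

Lemma eigenvalue_tens_affine m n (H : 'M[F]_m) (S : 'M[F]_n) (mu z : F)
    (hs ss : seq F) :
  char_poly H = \prod_(c <- hs) ('X - c%:P) ->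
  char_poly S = \prod_(c <- ss) ('X - c%:P) ->
  eigenvalue (1%:M *t S - mu *: (H *t S)) z ->
  exists h s, [/\ h \in hs, s \in ss & z = (1 - mu * h) * s].
Proof.
move=> Hhs Sss; set K := (_ - _); rewrite /eigenvalue => Ez0.
set H1 : 'M_(m * n) := H *t 1%:M; set S1 : 'M_(m * n) := 1%:M *t S.
have H1S1 : H1 *m S1 = H *t S by rewrite tensmx_mul mulmx1 mul1mx.
have KE : K = S1 - mu *: (H1 *m S1) by rewrite H1S1.
have HS : comm_mx H1 S1 by rewrite /comm_mx H1S1 tensmx_mul mulmx1 mul1mx.
have HK : comm_mx H1 K.
  rewrite KE -mul_scalar_mx.
  by apply/comm_mxB/comm_mxM/comm_mxM => //; apply: comm_mx_scalar.
have SK : comm_mx S1 K.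
  rewrite KE -mul_scalar_mx.
  have SH : comm_mx S1 H1 by rewrite /comm_mx HS.
  by apply/comm_mxB/comm_mxM/comm_mxM => //; apply: comm_mx_scalar.
have [||h hhs Vh0] := @stable_eigenvector _ (eigenspace K z) H1 hs _ Ez0.
- by rewrite tensmx1_prod char_poly_prod0 // tens0mx.
- exact: comm_mx_stable_eigenspace.
have [||s sss Vs0] := @stable_eigenvector _ _ S1 ss _ Vh0.
- by rewrite tens1mx_prod char_poly_prod0 // tensmx0.
(* The intersection is stable under [S1] because [S1] commutes with both [K] and [H1]. *)
- apply: (submx_trans (capmxMr _ _ _)); rewrite capmxS //.
  + exact: comm_mx_stable_eigenspace.
  + by apply: comm_mx_stable_eigenspace.
exists h, s; split=> //.
have /rowV0Pn[v] := Vs0.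
rewrite !sub_capmx -andbA => /and3P[].
move=> /eigenspaceP vK /eigenspaceP vH /eigenspaceP vS v0.
have : (z - (1 - mu * h) * s) *: v == 0.
  rewrite scalerBl -vK KE mulmxBr -scalemxAr mulmxA vS vH -scalemxAl vS.
  by rewrite !scalerA -!scalerBl scaler_eq0; apply/orP; left; apply/eqP; ring.
by rewrite scaler_eq0 (negPf v0) orbF subr_eq0 => /eqP.
Qed.

Lemma tens_affine_eigenvalue m n (H : 'M[F]_m) (S : 'M[F]_n) (mu h s : F) :
  eigenvalue H h -> eigenvalue S s ->
  eigenvalue (1%:M *t S - mu *: (H *t S)) ((1 - mu * h) * s).
Proof.
move=> /eigenvalueP[u uH u0] /eigenvalueP[v vS v0].
apply/eigenvalueP; exists (u *t v); last exact: tensmx_neq0.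
(* The row count of [u *t v] is written [1 * 1] so that [tensmx_mul] applies. *)
rewrite mulmxBr -scalemxAr; rewrite -[1%N]/(1 * 1)%N !tensmx_mul mulmx1 uH vS.
rewrite tensmxZl !tensmxZr !scalerA -scalerBl.
by congr (_ *: _); ring.
Qed.

End StableEigenvectors.

Local Open Scope complex_scope.

(** * Positivity of the spectrum of [H] for undirected graphs *)

Lemma undirected_sym (R : realType) N (E : rel 'I_N.+1) (A : 'M[R]_N.+1) :
  weighted_adjacency E A -> undirected E A -> forall i j, A i j = A j i.
Proof.
move=> [Adiag [_ A0]] undir i j.
have [->//|ij] := eqVneq i j.
have [/undir[_ //]|nEij] := boolP (E i j).
have [/undir[_ //]|nEji] := boolP (E j i).
by rewrite !A0 // eq_sym.
Qed.

(** Expanding the square gives a half carrying [(w x)^*] and a half carrying [(w y)^*]; exchanging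
    [x] and [y] identifies them, as [A] is symmetric. *)
Lemma sum_sym_sqr_diff (C : numClosedFieldType) n (A : 'I_n -> 'I_n -> C)
    (w : 'I_n -> C) : (forall x y, A x y = A y x) ->
  \sum_x \sum_y A x y * `|w x - w y| ^+ 2 =
  2 * \sum_x (w x)^* * (\sum_y A x y * (w x - w y)).
Proof.
move=> Asym; rewrite mulrDl mul1r.
have -> : \sum_x (w x)^* * (\sum_y A x y * (w x - w y)) =
          \sum_x \sum_y A x y * ((w x)^* * (w x - w y)).
  by apply: eq_bigr => x _; rewrite mulr_sumr; apply: eq_bigr => y _; ring.
rewrite [X in _ = _ + X]exchange_big -big_split /=.
apply: eq_bigr => x _; rewrite -big_split /=; apply: eq_bigr => y _.
by rewrite normCKC rmorphB /= [A y x]Asym; ring.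
Qed.

(** With value 0 at node 0, the weight from node 0 in the diagonal of [H] becomes an ordinary
    Laplacian term. Symmetry turns the column of [H] met by a left eigenvector into a row of [A]. *)
Lemma Hmatrix_left_eigenvector (R : realType) N (A : 'M[R]_N.+1)
    (v : 'rV[R[i]]_N) (z : R[i]) (w : 'I_N.+1 -> R[i]) :
  (forall i, A i i = 0) -> (forall i j, A i j = A j i) ->
  v *m cplx_mx (Hmatrix A) = z *: v ->
  w ord0 = 0 -> (forall k, w (lift ord0 k) = v 0 k) ->
  forall k, \sum_y (A (lift ord0 k) y)%:C * (w (lift ord0 k) - w y) = z * v 0 k.
Proof.
move=> Adiag Asym vH w0 wv k.
have <- : (v *m cplx_mx (Hmatrix A)) 0 k = z * v 0 k by rewrite vH mxE.
under eq_bigr do rewrite mulrBr.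
rewrite sumrB -mulr_suml [X in _ - X]big_ord_recl w0 mulr0 add0r.
rewrite mxE [X in _ - X](bigD1 k) //= [RHS](bigD1 k) //= !mxE eqxx Adiag.
rewrite !mul0r add0r.
rewrite wv -rmorph_sum mulrC; congr (_ + _); rewrite -sumrN.
apply: eq_bigr => l lk.
by rewrite !mxE (negPf lk) wv rmorphN /= Asym; ring.
Qed.

(** In the order of [R[i]], [0 < z] also says that [z] is real; this is what forces each [b l] to
    vanish in case (i). *)
Lemma undirected_eigenvalue_gt0 (R : realType) N (E : rel 'I_N.+1)
    (A : 'M[R]_N.+1) (z : R[i]) :
  weighted_adjacency E A -> undirected E A ->
  (forall i : 'I_N.+1, i != ord0 -> connect E ord0 i) ->
  eigenvalue (cplx_mx (Hmatrix A)) z -> 0 < z.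
Proof.
move=> A_adj undir reach /eigenvalueP[v vH v0].
have Asym := undirected_sym A_adj undir.
have [Adiag [Apos A0]] := A_adj.
pose w x := if unlift ord0 x is Some k then v 0 k else 0.
have w0 : w ord0 = 0 by rewrite /w unlift_none.
have wv k : w (lift ord0 k) = v 0 k by rewrite /w liftK.
have Hw := Hmatrix_left_eigenvector Adiag Asym vH w0 wv.
have Age0 x y : 0 <= (A x y)%:C.
  rewrite lecR; have [->|xy] := eqVneq x y; first by rewrite Adiag.
  by have [/(Apos _ _ xy)/ltW //|/(A0 _ _ xy) ->] := boolP (E y x).
have energy : \sum_x \sum_y (A x y)%:C * `|w x - w y| ^+ 2 =
    z * (2 * \sum_k `|v 0 k| ^+ 2).
  rewrite (sum_sym_sqr_diff (A := fun x y => (A x y)%:C)); last first.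
    by move=> x y; rewrite Asym.
  rewrite big_ord_recl w0 conjC0 mul0r add0r mulrCA; congr (_ * _).
  rewrite mulr_sumr; apply: eq_bigr => k _.
  by rewrite Hw wv normCKC; ring.
have norm_gt0 : 0 < 2 * \sum_k `|v 0 k| ^+ 2.
  have vk_ge0 k : true -> 0 <= `|v 0 k| ^+ 2 by rewrite exprn_ge0.
  rewrite mulr_gt0 // lt_neqAle eq_sym sumr_ge0 // andbT.
  apply: contraNneq v0 => /(psumr_eq0P vk_ge0) vk0; apply/eqP/rowP => k.
  by rewrite mxE; apply/eqP; rewrite -normr_eq0 -sqrf_eq0 vk0.
have term_ge0 x y : 0 <= (A x y)%:C * `|w x - w y| ^+ 2.
  by rewrite mulr_ge0 // exprn_ge0.
have energy_ge0 : 0 <= \sum_x \sum_y (A x y)%:C * `|w x - w y| ^+ 2.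
  by apply: sumr_ge0 => x _; apply: sumr_ge0.
have z_ge0 : 0 <= z by rewrite -(pmulr_lge0 _ norm_gt0) -energy.
rewrite lt_neqAle eq_sym z_ge0 andbT; apply: contraNneq v0 => z0.
(* If [z = 0], all energy terms vanish, so [w] is constant along edges, hence along paths from node
   0, where it is 0. *)
have term0 x y : (A x y)%:C * `|w x - w y| ^+ 2 = 0.
  move: energy; rewrite z0 mul0r.
  move=> /(psumr_eq0P (fun x _ => sumr_ge0 _ (fun y _ => term_ge0 x y))) /(_ x isT).
  by move=> /(psumr_eq0P (fun y _ => term_ge0 x y)) ->.
have w_edge x y : E x y -> w x = w y.
  have [->//|xy] := eqVneq x y; move=> Exy.
  apply/eqP; rewrite eq_sym -subr_eq0 -normr_eq0 -sqrf_eq0.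
  (* The indices are swapped: the edge from [x] to [y] carries [A y x]. *)
  have /eqP := term0 y x; rewrite mulf_eq0 => /orP[|//].
  have Ayx : 0 < A y x by apply: Apos; rewrite // eq_sym.
  by rewrite -(rmorph0 (real_complex R)) (inj_eq (@complexI R)) gt_eqF.
have w_path x p : path E x p -> w (last x p) = w x.
  elim: p x => //= y p IHp x /andP[/w_edge -> /IHp //].
apply/eqP/rowP => k; rewrite mxE -wv.
by have /connectP[p /w_path wp ->] := reach (lift ord0 k) isT; rewrite wp w0.
Qed.

(** * Strict bounds on extrema, and the eigenvalues of [H] as a list *)

(** For [n > 0] the default [f 0] is itself one of the terms, so it adds no constraint. *)
Lemma max_below_ltP (R : realType) n (f : nat -> R) x : (0 < n)%N ->
  reflect (forall l, (l < n)%N -> f l < x) (max_below n f < x).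
Proof.
rewrite /max_below big_mkord => n0; apply: (iffP (bigmax_ltP _ _ _ _)).
  by move=> [_ fx] l ln; apply: (fx (Ordinal ln)).
by move=> fx; split=> [|i _]; apply: fx.
Qed.

Lemma min_below_gtP (R : realType) n (f : nat -> R) x : (0 < n)%N ->
  reflect (forall l, (l < n)%N -> x < f l) (x < min_below n f).
Proof.
rewrite /min_below big_mkord => n0; apply: (iffP (bigmin_gtP _ _ _ _)).
  by move=> [_ fx] l ln; apply: (fx (Ordinal ln)).
by move=> fx; split=> [|i _]; apply: fx.
Qed.

(** For [l < N1] both conjugates coincide, so membership has one uniform description for all
    [l < N2], although the list repeats only the indices from [N1] on. *)
Lemma paired_eigenvalues_list (R : realType) N (M : 'M[R]_N) N1 N2 (a b : nat -> R) :
  paired_eigenvalues_of M N1 N2 a b ->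
  exists hs : seq R[i],
    char_poly (cplx_mx M) = \prod_(c <- hs) ('X - c%:P) /\
    forall c, c \in hs <->
      exists2 l, (l < N2)%N & c = a l +i* b l \/ c = a l -i* b l.
Proof.
move=> [[_ N12 _] [b0 _ ->]].
exists (map (fun l => a l +i* b l) (index_iota 0 N2) ++
        map (fun l => a l -i* b l) (index_iota N1 N2)); split.
  rewrite big_split /= big_cat !big_map /= mulrA; congr (_ * _).
  rewrite [RHS](big_cat_nat (n := N1)) //=; congr (_ * _).
  by apply: eq_big_nat => l /= lN1; rewrite b0.
move=> c; rewrite mem_cat; split.
  move=> /orP[] /mapP[l]; rewrite mem_index_iota => /andP[_ lN2] ->; exists l => //.
  - by left.
  - by right.
move=> [l lN2 cE]; apply/orP.
have [lN1|N1l] := ltnP l N1.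
  have -> : c = a l +i* b l by case: cE => ->; rewrite b0 // oppr0.
  by left; apply: map_f; rewrite mem_index_iota.
case: cE => ->; [left|right]; apply: map_f; rewrite mem_index_iota ?lN2 //.
by rewrite N1l.
Qed.

(** * From modulus bounds to intervals for the gain *)

Lemma normc_lt1_mul (R : realType) (h : R[i]) (mu r : R) (s : R[i]) : 0 < r ->
  normc s <= r -> normc (1 - mu%:C * h) < r^-1 -> normc ((1 - mu%:C * h) * s) < 1.
Proof.
move=> r0 sr h_lt; rewrite normcM.
have n0 : 0 <= normc (1 - mu%:C * h) by case: (1 - _) => ? ?; apply: sqrtr_ge0.
by apply: le_lt_trans (ler_wpM2l n0 sr) _; rewrite -ltr_pdivlMr // div1r.
Qed.

Lemma closed_loop_cplx (R : realType) N q (S0 : 'M[R]_q) (H : 'M[R]_N) mu :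
  cplx_mx (closed_loop S0 H mu) =
  1%:M *t cplx_mx S0 - mu%:C *: (cplx_mx H *t cplx_mx S0).
Proof.
by rewrite /cplx_mx /closed_loop map_mxB map_mxZ /= !map_mxT map_mx1.
Qed.

Lemma normc_1Bmu (R : realType) (mu x y : R) :
  normc (1 - mu%:C * (x +i* y)) = Num.sqrt ((1 - mu * x) ^+ 2 + (mu * y) ^+ 2).
Proof. by rewrite /=; congr Num.sqrt; ring. Qed.

Lemma normc_1Bmu_real (R : realType) (mu x : R) :
  normc (1 - mu%:C * x%:C) = `|1 - mu * x|.
Proof. by rewrite normc_1Bmu mulr0 expr0n addr0 sqrtr_sqr. Qed.

(** Multiplying by [r] turns the left side into [-1 < r - mu * x * r < 1]. *)
Lemma real_gain_interval (R : realType) (mu x r : R) : 0 < r -> 0 < x ->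
  (`|1 - mu * x| < r^-1) = ((r - 1) / (x * r) < mu < (r + 1) / (x * r)).
Proof.
move=> r0 x0; have xr0 : 0 < x * r by rewrite mulr_gt0.
rewrite ltr_pdivrMr // ltr_pdivlMr // -[r^-1]mul1r ltr_pdivlMr //.
rewrite -{1}(gtr0_norm r0) -normrM ltr_norml.
by apply/andP/andP => -[h1 h2]; split; lra.
Qed.

Lemma complex_gain_bound (R : realType) (mu x y r : R) : 0 < r ->
  (x - Num.sqrt (Delta r x y)) / (x ^+ 2 + y ^+ 2) < mu ->
  mu < (x + Num.sqrt (Delta r x y)) / (x ^+ 2 + y ^+ 2) ->
  Num.sqrt ((1 - mu * x) ^+ 2 + (mu * y) ^+ 2) < r^-1.
Proof.
set c := x ^+ 2 + y ^+ 2; set d := Num.sqrt _ => r0 lo hi.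
(* If [c = 0], both bounds are 0 since [0^-1 = 0], and no [mu] lies between them. *)
have c0 : 0 < c.
  rewrite lt_neqAle addr_ge0 ?sqr_ge0 // andbT; apply/eqP => c0.
  by have := lt_trans lo hi; rewrite -c0 invr0 !mulr0 ltxx.
rewrite ltr_pdivrMr // in lo; rewrite ltr_pdivlMr // in hi.
(* A nonempty interval forces [d > 0], so [Delta] is positive and [d] is a genuine root, not the
   value 0 given to negative arguments. *)
have d0 : 0 < d by lra.
have dE : d ^+ 2 = Delta r x y by rewrite sqr_sqrtr // ltW // -sqrtr_gt0.
have sq_lt : (mu * c - x) ^+ 2 < d ^+ 2.
  by rewrite -subr_gt0 subr_sqr mulr_gt0 //; lra.
rewrite -[r^-1]ger0_norm ?invr_ge0 1?ltW // -sqrtr_sqr ltr_sqrt; last first.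
  by rewrite exprn_gt0 // invr_gt0.
rewrite -(ltr_pM2l c0) exprVn.
have -> : c * ((1 - mu * x) ^+ 2 + (mu * y) ^+ 2) = (mu * c - x) ^+ 2 + y ^+ 2.
  by rewrite /c; ring.
(* By the choice of [Delta], [d ^+ 2 + y ^+ 2 = c / r ^+ 2]. *)
by rewrite dE /Delta -/c in sq_lt; lra.
Qed.

Theorem corollary3p1 (R : realType) (N q : nat)
    (E : rel 'I_N.+1) (A : 'M[R]_N.+1)
    (S0 : 'M[R]_q.+1) (lam : 'I_q.+1 -> R[i])
    (N1 N2 : nat) (a b : nat -> R)
    (N_gt0 : (0 < N)%N)
    (A_adj : weighted_adjacency E A)
    (reach : forall i : 'I_N.+1, i != ord0 -> connect E ord0 i)
    (lam_eig : eigenvalues_of S0 lam)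
    (lam_sorted : forall i j : 'I_q.+1, (i <= j)%N ->
       normc (lam i) <= normc (lam j))
    (lamq_neq0 : lam ord_max != 0)
    (H_eig : paired_eigenvalues_of (Hmatrix A) N1 N2 a b) :
  let H := Hmatrix A in
  let r : R := normc (lam ord_max) in
  (undirected E A ->
     let lo := max_below N (fun l => (r - 1) / (a l * r)) in
     let hi := min_below N (fun l => (r + 1) / (a l * r)) in
     [/\ (forall l, (l < N2)%N -> b l = 0) /\ N2 = N,
         (exists mu : R, is_Schur (closed_loop S0 H mu)) <-> lo < hi &
         lo < hi ->
         forall mu : R, lo < mu < hi -> is_Schur (closed_loop S0 H mu)]) /\
  ((forall k, normc (lam k) <= 1) ->
     forall mu : R,
       max_below N2 (fun l => (a l - Num.sqrt (Delta r (a l) (b l)))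
                              / (a l ^+ 2 + b l ^+ 2)) < mu <
       min_below N2 (fun l => (a l + Num.sqrt (Delta r (a l) (b l)))
                              / (a l ^+ 2 + b l ^+ 2)) ->
       is_Schur (closed_loop S0 H mu)).
Proof.
move=> H r.
have r0 : 0 < r.
  rewrite lt_neqAle; apply/andP; split.
    by apply: contra lamq_neq0; rewrite eq_sym => /eqP/eq0_normc ->.
  by rewrite /r; case: (lam ord_max) => ? ?; apply: sqrtr_ge0.
have [hs [Hhs hsP]] := paired_eigenvalues_list H_eig.
have Hroot c : eigenvalue (cplx_mx H) c = (c \in hs).
  by rewrite eigenvalue_root_char Hhs root_prod_XsubC.
have Sss : char_poly (cplx_mx S0) =
    \prod_(c <- [seq lam k | k : 'I_q.+1]) ('X - c%:P).
  by rewrite big_image /=.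
have Slam k : eigenvalue (cplx_mx S0) (lam k).
  by rewrite eigenvalue_root_char Sss root_prod_XsubC image_f.
(* Necessity tests the eigenvalue [lam ord_max], of modulus [r]; sufficiency uses that [r] bounds
   every [normc (lam k)]. *)
have SchurP mu : is_Schur (closed_loop S0 H mu) <->
    (forall c, c \in hs -> normc (1 - mu%:C * c) < r^-1).
  rewrite /is_Schur closed_loop_cplx; split=> [schur c chs|small z].
    have := schur _ (tens_affine_eigenvalue mu%:C _ (Slam ord_max)).
    move=> /(_ c); rewrite Hroot chs normcM => /(_ isT).
    by rewrite -[r^-1]mul1r ltr_pdivlMr.
  case/(eigenvalue_tens_affine Hhs Sss) => h [s [hhs /imageP[k _ ->] ->]].
  by apply: normc_lt1_mul (small h hhs) => //; apply: lam_sorted; apply: leq_ord.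
have [[N1N N12 N12N] [b0 bn0 _]] := H_eig.
have N2_gt0 : (0 < N2)%N.
  by case: (N2) N12 N12N => //; rewrite leqn0 => /eqP ->; case: (N) N_gt0.
split=> [undir lo hi|_ mu /andP[]]; last first.
  move=> /(max_below_ltP _ _ N2_gt0) lo /(min_below_gtP _ _ N2_gt0) hi.
  (* Conjugate eigenvalues give the same modulus, so one interval serves both. *)
  apply/SchurP => c /hsP[l lN2 [] ->]; rewrite normc_1Bmu ?mulrN ?sqrrN;
    exact: complex_gain_bound (lo l lN2) (hi l lN2).
have ab_gt0 l : (l < N2)%N -> b l = 0 /\ 0 < a l.
  move=> lN2; have : a l +i* b l \in hs by apply/hsP; exists l => //; left.
  rewrite -Hroot => /(undirected_eigenvalue_gt0 A_adj undir reach).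
  by rewrite ltcE /= => /andP[/eqP].
have N2N : N2 = N.
  (* Otherwise index [N1] would start a non-real pair, contradicting [b N1 = 0]. *)
  have N21 : N2 = N1.
    apply/eqP; rewrite eqn_leq N12 andbT leqNgt; apply/negP => N1N2.
    have : b N1 != 0 by apply: bn0; rewrite leqnn.
    by rewrite (ab_gt0 N1 N1N2).1 eqxx.
  by rewrite -N12N N21 subnn muln0 addn0.
have gainP mu : is_Schur (closed_loop S0 H mu) <-> lo < mu < hi.
  rewrite SchurP; split=> [small|/andP[]]; last first.
    move=> /(max_below_ltP _ _ N_gt0) lo_mu /(min_below_gtP _ _ N_gt0) mu_hi.
    move=> c /hsP[l lN2 cE]; have [bl al] := ab_gt0 l lN2.
    have -> : c = (a l)%:C by case: cE => ->; rewrite bl // oppr0.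
    by rewrite normc_1Bmu_real real_gain_interval // lo_mu ?mu_hi // -N2N.
  have bounds l : (l < N)%N -> (r - 1) / (a l * r) < mu < (r + 1) / (a l * r).
    rewrite -N2N => lN2; have [bl al] := ab_gt0 l lN2.
    rewrite -real_gain_interval // -normc_1Bmu_real small //.
    by apply/hsP; exists l => //; left; rewrite bl.
  by apply/andP; split; [apply/max_below_ltP|apply/min_below_gtP] => // l;
    move=> /bounds/andP[].
split; first by split=> // l /ab_gt0[].
- split=> [[mu /gainP/andP[]]|lohi]; first exact: lt_trans.
  (* The midpoint is an admissible gain. *)
  by exists ((lo + hi) / 2); apply/gainP; rewrite !(midf_lt lohi).
- by move=> _ mu /gainP.
Qed.
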